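(* Let $\mu$ be a symmetric probability measure on $\mathbb{R}$ such that $m_1(\mu)=0$, $m_2(\mu)=1$ and $m_4(\mu)<+\infty$. For $n\ge1$ let $\mu_n$ be the dilation of $\mu^{\uplus n}$ by $\frac1{\sqrt n}$, i.e. $\mu_n(A)=\mu^{\uplus n}\left(\{x:\frac1{\sqrt n}x\in A\}\right)$ for Borel sets $A$. Then for all $n\ge1$, $$\Psi(\mu_n|\mathrm{b})\le\Psi^*(\mu_n)\,D^*(\mu_n|\mathrm{b})=\frac1{\sqrt n}\,m_{-2}(\mu)\sqrt{m_4(\mu)-1}.$$
   Context: $\mathrm{b}=\frac12\delta_{-1}+\frac12\delta_{1}$ is the Rademacher distribution; $m_k(\mu)=\int x^k\,d\mu(x)$ for $k\in\mathbb{Z}$, with $m_{-2}(\mu)\in(0,+\infty]$. For a symmetric probability measure $\mu$ on $\mathbb{R}$: $\Psi(\mu|\mathrm{b})=\iint\frac{\log x^2-\log y^2}{x^2-y^2}\,d\mu(x)\,d\mu(y)+\int x^2\,d\mu(x)-2\in[0,+\infty]$, where the integrand of the double integral is understood with its continuous extension on the diagonal $x^2=y^2$ (value $1/x^2$, and $+\infty$ if $x=0$ or $y=0$); $\Psi^*(\mu)=\int\frac1{x^2}\,d\mu(x)\in(0,+\infty]$ (with $1/0=+\infty$); $D^*(\mu|\mathrm{b})=\left(\int(x^2-1)^2\,d\mu(x)\right)^{1/2}\in[0,+\infty]$. For a probability measure $\mu$ on $\mathbb{R}$ and $z$ in the upper half-plane, let $G_\mu(z)=\int\frac{1}{z-x}\,d\mu(x)$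 and $K_\mu(z)=z-1/G_\mu(z)$. The Boolean convolution $\mu\uplus\nu$ of two probability measures on $\mathbb{R}$ is the unique probability measure with $K_{\mu\uplus\nu}(z)=K_\mu(z)+K_\nu(z)$ for all $z$ with $\Im z>0$; $\mu^{\uplus n}$ is the $n$-fold Boolean convolution of $\mu$ with itself. *)

(* Defs.v *)
From HB Require Import structures.
From mathcomp Require Import all_boot all_order all_algebra.
From mathcomp Require Import complex.
From mathcomp Require Import all_classical all_reals all_analysis.
From mathcomp Require Import measurable_realfun.

Set Implicit Arguments.
Unset Strict Implicit.
Unset Printing Implicit Defensive.

Import Order.TTheory GRing.Theory Num.Theory.
Import numFieldNormedType.Exports.

Local Open Scope classical_set_scope.
Local Open Scope ring_scope.

Notation probR R := (probability (measurableTypeR R) R).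

Definition symmetric_law (R : realType) (mu : probR R) : Prop :=
  forall A : set (measurableTypeR R), measurable A ->
    mu ((fun x : R => - x) @^-1` A) = mu A.

(* Negative powers are taken in \bar R, where 0^-1 = +oo; in R the library
   convention 0^-1 = 0 would lose the mass at the origin. *)
Definition moment (R : realType) (mu : probR R) (k : int) : \bar R :=
  (\int[mu]_x match k with
              | Posz n => (x ^+ n)%:E
              | Negz n => ((x ^+ n.+1)%:E)^-1
              end)%E.

(* (log x^2 - log y^2) / (x^2 - y^2), extended by continuity to x^2 = y^2 and
   by +oo to x = 0 or y = 0. *)
Definition log_quotient (R : realType) (x y : R) : \bar R :=
  if (x == 0) || (y == 0) then +oo%E
  else if x ^+ 2 == y ^+ 2 then ((x ^+ 2)^-1)%:E
  else ((ln (x ^+ 2) - ln (y ^+ 2)) / (x ^+ 2 - y ^+ 2))%:E.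

(* Psi( . | b), Psi^* and D^*( . | b), with b the Rademacher distribution *)
Definition Psi (R : realType) (mu : probR R) : \bar R :=
  (\int[mu]_y (\int[mu]_x log_quotient x y)
   + \int[mu]_x (x ^+ 2)%:E - 2%:E)%E.

Definition Psi_star (R : realType) (mu : probR R) : \bar R :=
  (\int[mu]_x ((x ^+ 2)%:E)^-1)%E.

Definition D_star (R : realType) (mu : probR R) : \bar R :=
  sqrte (\int[mu]_x ((x ^+ 2 - 1) ^+ 2)%:E)%E.

(* The library integrates real functions only; the complex integral is taken
   componentwise. *)
Definition cauchy_transform (R : realType) (mu : probR R) (z : R[i]) : R[i] :=
  ((\int[mu]_x complex.Re ((z - x%:C)^-1))
   +i* (\int[mu]_x complex.Im ((z - x%:C)^-1)))%C.

Definition K_transform (R : realType) (mu : probR R) (z : R[i]) : R[i] :=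
  z - (cauchy_transform mu z)^-1.

(* Boolean convolution as a relation: the law rho is determined by mu and nu,
   its existence being the content of a theorem. *)
Definition is_boolean_conv (R : realType) (mu nu rho : probR R) : Prop :=
  forall z : R[i], 0 < complex.Im z ->
    K_transform rho z = K_transform mu z + K_transform nu z.

(* is_boolean_power mu n nu: nu is the n-fold Boolean convolution of mu with
   itself, n >= 1.  A probability is a function on all sets, so two of them are
   compared on the measurable ones. *)
Inductive is_boolean_power (R : realType) (mu : probR R) :
    nat -> probR R -> Prop :=
| boolean_power1 (nu : probR R) :
    (forall A, measurable A -> nu A = mu A) -> is_boolean_power mu 1 nu
| boolean_powerS (n : nat) (nu rho : probR R) :
    is_boolean_power mu n nu -> is_boolean_conv nu mu rho ->
    is_boolean_power mu n.+1 rho.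

Section dilation.
Context (R : realType) (c : R).

Definition scale_fun (x : measurableTypeR R) : measurableTypeR R := c * x.

Let measurable_scale_fun : measurable_fun setT scale_fun.
Proof. exact: mulrl_measurable. Qed.

HB.instance Definition _ := isMeasurableFun.Build _ _ _ _ scale_fun
  measurable_scale_fun.

End dilation.

Definition dilation (R : realType) (c : R) (mu : probR R) : probR R :=
  distribution mu (scale_fun c).

(* Main.v *)
(* Write S_P(t) for the integral of 1 / (x ^ 2 + t) against P.  On the imaginary
   axis Im G_P(iy) = - y S_P(y ^ 2), and G_mu(iy) is purely imaginary because mu
   is symmetric; hence additivity of K reads
   1 / S_nu(t) = n / S_mu(t) - (n - 1) t for the n-th Boolean power nu of mu.
   Letting t -> 0 gives m_{-2}(nu) = m_{-2}(mu) / n, and expanding to second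
   order as t -> +oo gives m_2(nu) = n and m_4(nu) = n (m_4(mu) + n - 1): this is
   the equality.
   For the inequality, the logarithmic mean dominates the geometric mean, so
   Psi is at most c ^ 2 - 1 with c = E 1/|x| >= 1 when E x ^ 2 = 1; then
   c ^ 2 - 1 <= 2 c (c - 1), and Cauchy-Schwarz bounds c - 1 <= c - E |x| =
   E ((1 - x ^ 2) (1/|x| - c)). *)
Require Import Defs.
From HB Require Import structures.
From mathcomp Require Import all_boot all_order all_algebra.
From mathcomp Require Import complex.
From mathcomp Require Import all_classical all_reals all_analysis.
From mathcomp Require Import measurable_realfun ring lra.

Import Order.TTheory GRing.Theory Num.Theory.
Import numFieldNormedType.Exports.

Local Open Scope classical_set_scope.
Local Open Scope ring_scope.

Set Implicit Arguments.
Unset Strict Implicit.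
Unset Printing Implicit Defensive.

(** * Logarithmic mean against geometric mean *)

(** With [u = ln r] this is 2u <= e^u - e^(-u) for u >= 0; the difference [f] has derivative e^u +
    e^(-u) - 2, nonnegative by e^x >= 1 + x at u and at -u. *)
Lemma ln_le_subV (R : realType) (r : R) : 1 <= r -> ln r *+ 2 <= r - r^-1.
Proof.
move=> r1; have r0 : 0 < r by exact: lt_le_trans r1.
pose f (u : R) := expR u - expR (- u) - u *+ 2.
have u0 : 0 <= ln r by exact: ln_ge0.
have df (x : R) : is_derive x 1 f (expR x + expR (- x) - 2).
  have -> : f = fun u => expR u - expR (- u) - 2 * u.
    by apply/funext => u; rewrite /f mulr_natl.
  apply: is_derive_eq; rewrite mulrN1 opprK; congr (_ - _); exact: mulr1.
have : f 0 <= f (ln r).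
  apply: (@ger0_derive1_le_cc _ f 0 (ln r)); rewrite ?in_itv/= ?lexx//.
  - move=> x _ ; rewrite derive1E derive_val.
    by have := expR_ge1Dx x; have := expR_ge1Dx (- x); lra.
  - by apply: derivable_within_continuous => x _.
  - by rewrite u0.
rewrite /f oppr0 expR0 subrr mul0rn expRN lnK ?posrE//; lra.
Qed.

Lemma log_quotient_ge0 (R : realType) (x y : R) : (0 <= log_quotient x y)%E.
Proof.
rewrite /log_quotient; case: ifPn => // /norP[x0 y0].
have X : 0 < x ^+ 2 by rewrite exprn_even_gt0.
have Y : 0 < y ^+ 2 by rewrite exprn_even_gt0.
case: eqVneq => [e|e]; rewrite lee_fin; first by rewrite invr_ge0 ltW.
have [xy|xy] := ltP (x ^+ 2) (y ^+ 2).
  rewrite -mulrNN -invrN divr_ge0// oppr_ge0 subr_le0 ?ler_ln ?posrE// ltW//.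
by rewrite divr_ge0// subr_ge0 ?ler_ln ?posrE.
Qed.

(** Take [r = a / b] in [ln_le_subV]: the right side a/b - b/a equals (a^2 - b^2) / (ab). *)
Lemma log_mean_ge_sqrt (R : realType) (a b : R) : 0 < b -> b < a ->
  (ln (a ^+ 2) - ln (b ^+ 2)) / (a ^+ 2 - b ^+ 2) <= a^-1 * b^-1.
Proof.
move=> b0 ba; have a0 : 0 < a by exact: lt_trans ba.
rewrite ler_pdivrMr; last by rewrite subr_gt0 ltr_pXn2r// ?nnegrE ltW.
rewrite !lnXn// -mulrnBl -ln_div ?posrE//.
apply: le_trans (ln_le_subV _) _; first by rewrite ler_pdivlMr ?mul1r ?ltW.
by rewrite le_eqVlt; apply/orP; left; apply/eqP; field; rewrite !gt_eqF.
Qed.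

(** The bound is a product of a function of x and a function of y, so it splits the double integral.
    On the axes both sides are [+oo]. *)
Lemma log_quotient_le (R : realType) (x y : R) :
  (log_quotient x y <= (`|x|%:E)^-1 * (`|y|%:E)^-1)%E.
Proof.
rewrite !inver /log_quotient !normr_eq0.
have [->|x0]/= := eqVneq x 0.
  by case: eqVneq => y0; rewrite ?mulyy// gt0_mulye// lte_fin invr_gt0 normr_gt0.
have [y0|y0]/= := eqVneq y 0.
  by rewrite gt0_muley// lte_fin invr_gt0 normr_gt0.
have ax : 0 < `|x| by rewrite normr_gt0.
have ay : 0 < `|y| by rewrite normr_gt0.
rewrite -EFinM -(real_normK (num_real x)) -(real_normK (num_real y)).
rewrite eqrXn2//; case: (ltgtP `|x| `|y|) => xy; rewrite lee_fin.
- rewrite -mulrNN -invrN !opprB [leRHS]mulrC; exact: log_mean_ge_sqrt.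
- exact: log_mean_ge_sqrt.
- by rewrite xy -invfM expr2.
Qed.

(** * Measurability, and integrals bundled with integrability *)

(** Inversion jumps at 0, so it is written as x times a real power of x^2; the factor x gives the
    value 0 at the origin. *)
Lemma measurable_invr (R : realType) : measurable_fun [set: R] (@GRing.inv R).
Proof.
have -> : @GRing.inv R = fun x => x * powR (x ^+ 2) (- 1).
  apply/funext => x; rewrite powR_inv1 ?sqr_ge0//.
  have [->|x0] := eqVneq x 0; first by rewrite invr0 mul0r.
  by rewrite expr2 invfM mulrA mulfV// mul1r.
apply: measurable_funM => //.
have mX : measurable_fun [set: R] (fun x : R => x ^+ 2) by exact: measurable_funX.
exact: (measurableT_comp (@measurable_powR R (- 1)) mX).
Qed.

Lemma measurable_inve_EFin d (T : measurableType d) (R : realType) (f : T -> R) :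
  measurable_fun setT f -> measurable_fun setT (fun x => ((f x)%:E)^-1%E).
Proof.
move=> mf; under eq_fun do rewrite inver.
apply: measurable_fun_ifT => //; first exact: measurable_fun_eqr.
by apply/measurable_EFinP; exact: (measurableT_comp (@measurable_invr R) mf).
Qed.

(* Unlike [ge0_le_integral], this asks nothing of [f], so that the inner
   integral of [Psi] never has to be shown measurable. *)
Lemma le_integral_ge0 d (T : measurableType d) (R : realType)
    (mu : {measure set T -> \bar R}) (f g : T -> \bar R) :
  (forall x, 0 <= f x)%E -> (forall x, f x <= g x)%E ->
  (\int[mu]_x f x <= \int[mu]_x g x)%E.
Proof.
move=> f0 fg; have g0 x : (0 <= g x)%E by exact: le_trans (f0 x) (fg x).
rewrite !ge0_integralTE//; apply: ereal_sup_le => _ [h hf <-].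
by exists h => // x; exact: le_trans (hf x) (fg x).
Qed.

(** Integrability and value travel together, so that linear combinations of finite integrals can be
    formed without side conditions. *)
Definition has_mean d (T : measurableType d) (R : realType)
    (P : probability T R) (g : T -> R) (m : R) :=
  P.-integrable setT (EFin \o g) /\ (\int[P]_x (g x)%:E = m%:E)%E.

Section has_mean.
Context d (T : measurableType d) (R : realType) (P : probability T R).
Implicit Types (f g : T -> R) (a b m : R).

Lemma has_mean_cst a : has_mean P (cst a) a.
Proof.
split; first exact: finite_measure_integrable_cst.
rewrite [LHS](integral_cst P measurableT a%:E).
by rewrite -[RHS]mule1 -(probability_setT P).
Qed.

Lemma has_meanD f g a b : has_mean P f a -> has_mean P g b ->
  has_mean P (fun x => f x + g x) (a + b).
Proof.
move=> [fi fa] [gi gb]; split; first exact: integrableD fi gi.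
by rewrite integralD_EFin// fa gb.
Qed.

Lemma has_meanZ k f a : has_mean P f a -> has_mean P (fun x => k * f x) (k * a).
Proof.
move=> [fi fa]; split; first exact: integrableZl fi.
by under eq_integral do rewrite EFinM; rewrite integralZl// fa.
Qed.

Lemma has_mean_ge0 f a : measurable_fun setT f -> (forall x, 0 <= f x) ->
  (\int[P]_x (f x)%:E = a%:E)%E -> has_mean P f a.
Proof.
move=> mf f0 fa; split => //; apply/integrableP; split.
  exact/measurable_EFinP.
by under eq_integral do rewrite /= ger0_norm//; rewrite fa ltry.
Qed.

Lemma le_has_mean f g a b : has_mean P f a -> has_mean P g b ->
  (forall x, f x <= g x) -> a <= b.
Proof.
move=> [fi fa] [gi gb] fg; rewrite -lee_fin -fa -gb.
by apply: le_integral => // x _; rewrite lee_fin.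
Qed.

Lemma has_mean_dominated f g b : measurable_fun setT f -> has_mean P g b ->
  (forall x, `|f x| <= g x) -> exists a, has_mean P f a.
Proof.
move=> mf [gi _] fg.
have fi : P.-integrable setT (EFin \o f).
  apply: le_integrable gi => //; first exact/measurable_EFinP.
  by move=> x _; rewrite lee_fin (le_trans (fg x))// ler_norm.
by exists (fine (\int[P]_x (f x)%:E)); split => //; rewrite fineK// integrable_fin_num.
Qed.

End has_mean.

(** * The inequality between the functionals *)

(* To be used with [X = x ^ 2] and [F = 1 / |x|].  The weight [l] below is the
   one realizing [c - 1 <= sqrt V * sqrt (M - c ^ 2)] followed by
   [2 c sqrt (M - c ^ 2) <= M], perturbed by [e] because [V] may vanish. *)
Lemma sqr_mean_sub1_le d (T : measurableType d) (R : realType)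
    (P : probability T R) (X F : T -> R) (c M V : R) :
  has_mean P X 1 -> has_mean P (fun x => (X x - 1) ^+ 2) V ->
  has_mean P F c -> has_mean P (fun x => F x ^+ 2) M ->
  (forall x, F x - 2^-1 * (1 + X x) <= (1 - X x) * F x) ->
  (forall x, 3 / 2 - 2^-1 * X x <= F x) ->
  c ^+ 2 - 1 <= M * Num.sqrt V.
Proof.
move=> hX hV hF hF2 h1 h2.
have V0 : 0 <= V.
  by apply: le_has_mean (has_mean_cst P 0) hV _ => x; exact: sqr_ge0.
have c1 : 1 <= c.
  have := le_has_mean (has_meanD (has_mean_cst P (3/2)) (has_meanZ (- 2^-1) hX)) hF.
  have H x : cst (3 / 2) x + - 2^-1 * X x <= F x by rewrite mulNr; exact: h2.
  by move/(_ H); lra.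
(* This is the mean of (F - k)^2, expanded in the shape that [has_meanD] and [has_meanZ] produce. *)
have hvar k : 0 <= M + (k ^+ 2 + - (2 * k) * c).
  apply: le_has_mean (has_mean_cst P 0)
    (has_meanD hF2 (has_meanD (has_mean_cst P (k ^+ 2)) (has_meanZ (- (2 * k)) hF))) _.
  by move=> x; have := sqr_ge0 (F x - k); rewrite /=; nra.
have cM : c ^+ 2 <= M by have := hvar c; nra.
have M0 : 0 < M by nra.
apply/ler_addgt0Pr => e e0.
pose w := Num.sqrt V + e / M.
have w0 : 0 < w by rewrite ltr_wpDl ?sqrtr_ge0// divr_gt0.
have -> : M * Num.sqrt V + e = M * w by rewrite /w; field; rewrite gt_eqF.
have Vw : V <= w ^+ 2.
  rewrite -(sqr_sqrtr V0) ler_pXn2r ?nnegrE ?sqrtr_ge0 ?(ltW w0)//.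
  by rewrite lerDl ltW ?divr_gt0.
pose l := M / (2 * w * c).
have l0 : 0 < l by rewrite divr_gt0// !mulr_gt0//; lra.
(* Mean of the pointwise bound F - (1 + X)/2 - c(1 - X) <= (1 - X)(F - c) <= (l(X - 1)^2 + (F - c)^2
   / l) / 2, which comes from [h1] and the weighted AM-GM inequality. *)
have cb : c - 1 <= 2^-1 * (l * V + l^-1 * (M + (c ^+ 2 + - (2 * c) * c))).
  have := has_meanD hF (has_meanD (has_mean_cst P (- (2^-1 + c)))
    (has_meanZ (c - 2^-1) hX)).
  have := has_meanZ 2^-1 (has_meanD (has_meanZ l hV) (has_meanZ l^-1
    (has_meanD hF2 (has_meanD (has_mean_cst P (c ^+ 2))
      (has_meanZ (- (2 * c)) hF))))).
  move=> /[swap] /le_has_mean/[apply].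
  have -> : c + (- (2^-1 + c) + (c - 2^-1) * 1) = c - 1 by field.
  apply => x /=.
  have := h1 x; set A := X x; set B := F x => h1x.
  have -> : B ^+ 2 + (c ^+ 2 + - (2 * c) * B) = (B - c) ^+ 2 by ring.
  apply: (@le_trans _ _ ((1 - A) * (B - c))); first lra.
  have : 0 <= l^-1 * (l * (1 - A) - (B - c)) ^+ 2.
    by rewrite mulr_ge0 ?sqr_ge0 ?invr_ge0 ?ltW.
  have -> : l^-1 * (l * (1 - A) - (B - c)) ^+ 2 =
     l * (A - 1) ^+ 2 + l^-1 * (B - c) ^+ 2 - 2 * ((1 - A) * (B - c)).
    by field; rewrite gt_eqF.
  lra.
(* The difference of the two sides is (c - 1)^2. *)
have cb2 : c ^+ 2 - 1 <= 2 * c * (c - 1) by nra.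
apply: le_trans cb2 _.
(* With the chosen [l], each of the two terms of [cb], once multiplied by 2c, is at most M w / 2. *)
have lV : l * V <= M * w / (2 * c).
  have -> : M * w / (2 * c) = l * w ^+ 2.
    by rewrite /l; field; rewrite !gt_eqF//; lra.
  by rewrite ler_pM2l.
have q : c ^+ 2 * (M - c ^+ 2) <= M ^+ 2 / 4.
  by have := sqr_ge0 (M - 2 * c ^+ 2); lra.
have lq : c * l^-1 * (M - c ^+ 2) <= M * w / 2.
  have -> : c * l^-1 * (M - c ^+ 2) = (2 * w / M) * (c ^+ 2 * (M - c ^+ 2)).
    by rewrite /l; field; rewrite !gt_eqF//; lra.
  have -> : M * w / 2 = (2 * w / M) * (M ^+ 2 / 4) by field; rewrite gt_eqF.
  by rewrite ler_pM2l// divr_gt0// mulr_gt0.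
have clV : c * (l * V) <= M * w / 2.
  have -> : M * w / 2 = c * (M * w / (2 * c)).
    by field; rewrite !gt_eqF//; lra.
  by rewrite ler_pM2l//; lra.
apply: le_trans (ler_wpM2l _ cb) _; first lra.
have -> : 2 * c * (2^-1 * (l * V + l^-1 * (M + (c ^+ 2 + - (2 * c) * c)))) =
  c * (l * V) + c * l^-1 * (M - c ^+ 2) by field; rewrite gt_eqF.
lra.
Qed.

Lemma integral_log_quotient_le (R : realType) (P : probR R) :
  (\int[P]_y (\int[P]_x log_quotient x y) <= (\int[P]_x (`|x|%:E)^-1) ^+ 2)%E.
Proof.
have mn : measurable_fun [set: measurableTypeR R] (fun x : R => (`|x|%:E)^-1%E).
  by apply: measurable_inve_EFin; exact: normr_measurable.
have n0 (x : R) : (0 <= (`|x|%:E)^-1)%E by rewrite inve_ge0 lee_fin.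
have I0 : (0 <= \int[P]_x (`|x|%:E)^-1)%E by exact: integral_ge0.
apply: (@le_trans _ _ (\int[P]_y ((\int[P]_x (`|x|%:E)^-1) * (`|y|%:E)^-1))%E).
  apply: le_integral_ge0 => y.
    by apply: integral_ge0 => x _; exact: log_quotient_ge0.
  rewrite -ge0_integralZr//.
  apply: le_integral_ge0 => x; first exact: log_quotient_ge0.
  exact: log_quotient_le.
by rewrite ge0_integralZl.
Qed.

Lemma Psi_le (R : realType) (P : probR R) :
  (\int[P]_x (x ^+ 2)%:E = 1)%E ->
  (\int[P]_x ((x ^+ 2 - 1) ^+ 2)%:E < +oo)%E ->
  (Psi P <= Psi_star P * D_star P)%E.
Proof.
move=> X1 Vfin.
have mX : measurable_fun [set: measurableTypeR R] (fun x : R => x ^+ 2).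
  exact: measurable_funX.
have mX1 : measurable_fun [set: measurableTypeR R] (fun x : R => (x ^+ 2 - 1) ^+ 2).
  by apply: measurable_funX; exact: measurable_funB.
have mXV : measurable_fun [set: measurableTypeR R] (fun x : R => ((x ^+ 2)%:E)^-1%E).
  exact: measurable_inve_EFin.
have [V EV] : exists V, (\int[P]_x ((x ^+ 2 - 1) ^+ 2)%:E = V%:E)%E.
  exists (fine (\int[P]_x ((x ^+ 2 - 1) ^+ 2)%:E)); rewrite fineK//.
  by rewrite ge0_fin_numE// integral_ge0// => x _; rewrite lee_fin sqr_ge0.
have hX : has_mean P (fun x => x ^+ 2) 1.
  by apply: has_mean_ge0 => // x; exact: sqr_ge0.
have hV : has_mean P (fun x => (x ^+ 2 - 1) ^+ 2) V.
  by apply: has_mean_ge0 => // x; exact: sqr_ge0.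
have V0 : 0 <= V.
  by apply: le_has_mean (has_mean_cst P 0) hV _ => x; exact: sqr_ge0.
have -> : D_star P = (Num.sqrt V)%:E by rewrite /D_star EV.
have S0 : (0 <= Psi_star P)%E.
  by apply: integral_ge0 => x _; rewrite inve_ge0 lee_fin sqr_ge0.
have [Soo|Sfin] := eqVneq (Psi_star P) +oo%E.
  (* The product of [+oo] and 0 is 0, so V = 0 must be excluded: it forces x^2 = 1 almost
     everywhere, hence [Psi_star P = 1]. *)
  have [VE|Vn0] := eqVneq V 0.
    suff : Psi_star P = 1%E by rewrite Soo.
    rewrite /Psi_star -[RHS](has_mean_cst P 1).2.
    apply: ge0_ae_eq_integral => //.
    - exact/measurable_EFinP.
    - by move=> x _; rewrite inve_ge0 lee_fin sqr_ge0.
    - have : (\int[P]_x `|((x ^+ 2 - 1) ^+ 2)%:E| = 0)%E.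
        under eq_integral do rewrite /= ger0_norm ?sqr_ge0//.
        by rewrite EV VE.
      have mE : measurable_fun [set: measurableTypeR R]
          (fun x : R => ((x ^+ 2 - 1) ^+ 2)%:E) by exact/measurable_EFinP.
      move=> /(ae_eq_integral_abs P measurableT mE).
      apply: filterS => x /(_ I) /= [] /eqP; rewrite sqrf_eq0 subr_eq0 => /eqP -> _.
      by rewrite inve1.
  by rewrite Soo gt0_mulye ?leey// lte_fin sqrtr_gt0 lt_neqAle eq_sym Vn0.
have [M EM] : exists M, Psi_star P = M%:E.
  by exists (fine (Psi_star P)); rewrite fineK// ge0_fin_numE// ltey.
have iS : P.-integrable setT (fun x => ((x ^+ 2)%:E)^-1%E).
  apply/integrableP; split=> //.
  under eq_integral do rewrite gee0_abs ?inve_ge0 ?lee_fin ?sqr_ge0//.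
  by rewrite -/(Psi_star P) EM ltry.
(* A finite integral of 1/x^2 makes the origin a null set. *)
have neq0 (x : R) : ((x ^+ 2)%:E)^-1%E \is a fin_num -> x != 0.
  by apply: contraTneq => ->; rewrite expr0n inver eqxx.
(* The value at the null point 0 is chosen so that the pointwise inequalities
   of [sqr_mean_sub1_le] hold there too. *)
pose F (x : R) : R := if x == 0 then 2 else `|x|^-1.
have F0 x : 0 <= F x by rewrite /F; case: ifP => // _; rewrite invr_ge0.
have mF : measurable_fun [set: measurableTypeR R] F.
  apply: measurable_fun_ifT => //; first exact: measurable_fun_eqr.
  apply: (measurableT_comp (@measurable_invr R)).
  exact: normr_measurable.
have mF2 : measurable_fun [set: measurableTypeR R] (fun x => F x ^+ 2).
  exact: measurable_funX.
have hF2 : has_mean P (fun x => F x ^+ 2) M.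
  apply: has_mean_ge0 => //; first by move=> x; exact: sqr_ge0.
  rewrite -EM; apply: ge0_ae_eq_integral => //.
  - exact/measurable_EFinP.
  - by move=> x _; rewrite lee_fin sqr_ge0.
  - by move=> x _; rewrite inve_ge0 lee_fin sqr_ge0.
  - apply: filterS (integrable_ae measurableT iS) => x /(_ I)/neq0 x0 _.
    rewrite inver sqrf_eq0 /F (negbTE x0).
    by rewrite exprVn real_normK// num_real.
have [c hF] : exists c, has_mean P F c.
  apply: has_mean_dominated (has_meanD (has_mean_cst P 1) hF2) _ => //= x.
  by rewrite ger0_norm//; have := sqr_ge0 (F x - 2^-1); lra.
have EC : (\int[P]_x (`|x|%:E)^-1 = c%:E)%E.
  rewrite -hF.2; apply: ge0_ae_eq_integral => //.
  - by apply: measurable_inve_EFin; exact: normr_measurable.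
  - exact/measurable_EFinP.
  - by move=> x _; rewrite inve_ge0 lee_fin.
  - by move=> x _; rewrite lee_fin.
  - apply: filterS (integrable_ae measurableT iS) => x /(_ I)/neq0 x0 _.
    by rewrite inver normr_eq0 /F (negbTE x0).
(* With a = |x| > 0 the two pointwise hypotheses reduce to (a - 1)^2 >= 0 and, after multiplication
   by a, to (a - 1)^2 (a + 2) >= 0. *)
have cM : c ^+ 2 - 1 <= M * Num.sqrt V.
  apply: sqr_mean_sub1_le hX hV hF hF2 _ _ => x; rewrite /F;
    have [->|x0] := eqVneq x 0; rewrite ?expr0n/=; try lra.
  - rewrite -(real_normK (num_real x)); have : 0 < `|x| by rewrite normr_gt0.
    move: `|x| => a a0; have := sqr_ge0 (a - 1).
    have -> : (1 - a ^+ 2) * a^-1 = a^-1 - a by field; rewrite gt_eqF.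
    lra.
  - rewrite -(real_normK (num_real x)); have : 0 < `|x| by rewrite normr_gt0.
    move: `|x| => a a0; rewrite -(ler_pM2r a0) mulVf ?gt_eqF//.
    have := mulr_ge0 (ltW a0) (sqr_ge0 (a - 1)); have := sqr_ge0 (a - 1); nra.
rewrite /Psi X1 EM -EFinM.
have := integral_log_quotient_le P; rewrite EC => LQ.
apply: (@le_trans _ _ (c%:E ^+ 2 + 1 - 2%:E)%E).
  by rewrite leeD2r// leeD2r.
by rewrite lee_fin; move: cM; rewrite /GRing.one/=; lra.
Qed.

(** * The Cauchy transform on the imaginary axis *)

Definition resolvent (R : realType) (P : probR R) (t : R) : R :=
  \int[P]_x (x ^+ 2 + t)^-1.

(** The law is its own image under negation, so the integral equals its opposite. *)
Lemma integral_odd_symmetric (R : realType) (mu : probR R) (f : R -> R) :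
  symmetric_law mu -> mu.-integrable setT (EFin \o f) ->
  (forall x, f (- x) = - f x) -> \int[mu]_x f x = 0.
Proof.
move=> smu fi fodd.
pose opp (x : measurableTypeR R) : measurableTypeR R := - x.
have mN : measurable_fun setT opp.
  exact: oppr_measurable.
have mf : measurable_fun setT (EFin \o f) by case/integrableP: fi.
have fNi : mu.-integrable setT (fun x => (EFin \o f) (- x)).
  have -> : (fun x => (EFin \o f) (- x)) = -%E \o (EFin \o f).
    by apply/funext => x; rewrite /= fodd EFinN.
  exact: integrableN.
have E : (\int[mu]_x (f x)%:E = - \int[mu]_x (f x)%:E)%E.
  rewrite -[in RHS]integralN; last first.
    by rewrite fin_num_adde_defl// fin_numN integrable_neg_fin_num.
  transitivity (\int[pushforward mu opp]_x (f x)%:E)%E.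
    by apply: eq_measure_integral => A mA _; exact/esym/smu.
  rewrite integral_pushforward//.
  by apply: eq_integral => x _ /=; rewrite fodd.
have : \int[mu]_x f x = - \int[mu]_x f x.
  by rewrite /Rintegral {1}E fineN.
lra.
Qed.

Section resolvent.
Context (R : realType) (P : probR R).
Implicit Types (t y : R).

Lemma measurable_resolvent t : measurable_fun [set: measurableTypeR R]
  (fun x : R => (x ^+ 2 + t)^-1).
Proof.
apply: (measurableT_comp (@measurable_invr R)).
by apply: measurable_funD => //; exact: measurable_funX.
Qed.

Lemma sqrD_gt0 t (x : R) : 0 < t -> 0 < x ^+ 2 + t.
Proof. by move=> t0; rewrite ltr_wpDl ?sqr_ge0. Qed.

Lemma has_mean_resolvent t : 0 < t ->
  has_mean P (fun x => (x ^+ 2 + t)^-1) (resolvent P t).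
Proof.
move=> t0.
have [|S hS] := has_mean_dominated (measurable_resolvent t) (has_mean_cst P t^-1).
  move=> x; have xt := sqrD_gt0 x t0.
  rewrite /= ger0_norm; last by rewrite invr_ge0 ltW.
  by rewrite lef_pV2 ?posrE// lerDr sqr_ge0.
by have -> : resolvent P t = S by rewrite /resolvent /Rintegral hS.2.
Qed.

(** A zero integral would make the positive integrand vanish almost everywhere; then 1 = 0 almost
    everywhere, against total mass 1. *)
Lemma resolvent_gt0 t : 0 < t -> 0 < resolvent P t.
Proof.
move=> t0; have hS := has_mean_resolvent t0.
rewrite lt_neqAle; apply/andP; split; last first.
  apply: le_has_mean (has_mean_cst P 0) hS _ => x.
  by rewrite invr_ge0 ltW// sqrD_gt0.
apply/eqP => S0; have : (\int[P]_x `|((x ^+ 2 + t)^-1)%:E| = 0)%E.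
  under eq_integral do rewrite /= ger0_norm ?invr_ge0 ?(ltW (sqrD_gt0 _ t0))//.
  by rewrite hS.2 -S0.
have mE : measurable_fun [set: measurableTypeR R]
    (fun x : R => ((x ^+ 2 + t)^-1)%:E).
  by apply/measurable_EFinP; exact: measurable_resolvent.
move=> /(ae_eq_integral_abs P measurableT mE) ae0.
suff : (\int[P]_x (cst 1 x)%:E = \int[P]_x (cst 0 x)%:E)%E.
  rewrite (has_mean_cst P 1).2 (has_mean_cst P 0).2 => -[] /eqP.
  by rewrite oner_eq0.
apply: ge0_ae_eq_integral => //; try exact/measurable_EFinP.
apply: filterS ae0 => x /(_ I) /= [] /eqP.
by rewrite invr_eq0 gt_eqF ?sqrD_gt0.
Qed.

Lemma resolvent_le t : 0 < t -> t * resolvent P t <= 1.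
Proof.
move=> t0; apply: le_has_mean (has_meanZ t (has_mean_resolvent t0))
  (has_mean_cst P 1) _ => x /=.
have xt := sqrD_gt0 x t0.
by rewrite ler_pdivrMr// mul1r lerDr sqr_ge0.
Qed.

Lemma Im_cauchy_transform y : 0 < y ->
  complex.Im (cauchy_transform P (0 +i* y)%C) = - (y * resolvent P (y ^+ 2)).
Proof.
move=> y0; have [ir _] := has_mean_resolvent (exprn_gt0 2 y0).
rewrite /= -mulNr -RintegralZl//; apply: eq_Rintegral => x _ /=.
by rewrite subr0 sub0r sqrrN mulNr.
Qed.

Lemma Re_cauchy_transform y : symmetric_law P -> 0 < y ->
  complex.Re (cauchy_transform P (0 +i* y)%C) = 0.
Proof.
move=> sP y0; have t0 := exprn_gt0 2 y0.
pose f (x : R) := - x * (x ^+ 2 + y ^+ 2)^-1.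
have -> : complex.Re (cauchy_transform P (0 +i* y)%C) = \int[P]_x f x.
  by apply: eq_Rintegral => x _ /=; rewrite subr0 sub0r sqrrN.
apply: integral_odd_symmetric => //; last first.
  by move=> x; rewrite /f sqrrN opprK mulNr opprK.
have mf : measurable_fun [set: measurableTypeR R] f.
  by apply: measurable_funM; [exact: oppr_measurable|exact: measurable_resolvent].
(* The bound 1/y holds because y|x| <= x^2 + y^2. *)
have [|m []//] := has_mean_dominated mf (has_mean_cst P y^-1).
move=> x; have xt := sqrD_gt0 x t0.
rewrite /f /= normrM normrN (gtr0_norm (x := _^-1)) ?invr_gt0//.
rewrite ler_pdivrMr// mulrC ler_pdivlMr//.
rewrite -(real_normK (num_real x)).
have := normr_ge0 x; move: `|x| => a a0.
by have := sqr_ge0 (a - y); nra.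
Qed.

End resolvent.

(** * Resolvents of Boolean powers *)

Lemma cauchy_transform_eq (R : realType) (mu nu : probR R) (z : R[i]) :
  (forall A, measurable A -> nu A = mu A) ->
  cauchy_transform nu z = cauchy_transform mu z.
Proof.
move=> e; congr (_ +i* _)%C; congr fine;
  by apply: eq_measure_integral => A mA _; exact: e.
Qed.

Lemma K_transform_boolean_power (R : realType) (mu nu : probR R) (n : nat) (z : R[i]) :
  is_boolean_power mu n nu -> 0 < complex.Im z ->
  K_transform nu z = K_transform mu z *+ n.
Proof.
move=> H z0; elim: H => [{}nu e|{}n {}nu rho _ IH /(_ z z0) ->].
  by rewrite /K_transform (cauchy_transform_eq z e) mulr1n.
by rewrite IH mulrSr.
Qed.

(** The convention [0^-1 = 0] covers b = 0, so the formula applies to a value not yet known to be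
    nonzero. *)
Lemma complex_imag_inv (R : realType) (b : R) :
  ((0 +i* b)^-1 = 0 +i* (- b^-1))%C.
Proof.
have [->|b0] := eqVneq b 0.
  by apply/eqP; rewrite eq_complex /= !(mul0r, mulr0, invr0, oppr0) eqxx.
apply/eqP; rewrite eq_complex /= mul0r eqxx /= expr0n add0r; apply/eqP; by field.
Qed.

Lemma complexMn (R : realType) (a b : R) (n : nat) :
  ((a +i* b) *+ n = (a *+ n) +i* (b *+ n))%C.
Proof. by elim: n => // n IH; rewrite mulrS IH !mulrS. Qed.

(* Nonsymmetric [nu] needs no separate treatment: [K_transform nu] is purely
   imaginary at [iy] because [K_transform mu] is. *)
Lemma resolvent_boolean_power (R : realType) (mu nu : probR R) (n : nat) (t : R) :
  symmetric_law mu -> is_boolean_power mu n nu -> 0 < t ->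
  (resolvent nu t)^-1 = n%:R * (resolvent mu t)^-1 - (n%:R - 1) * t.
Proof.
move=> smu H t0; pose y := Num.sqrt t.
have y0 : 0 < y by rewrite sqrtr_gt0.
have yt : y ^+ 2 = t by rewrite sqr_sqrtr// ltW.
have Smu := resolvent_gt0 mu t0; have Snu := resolvent_gt0 nu t0.
have yImz : 0 < complex.Im (0 +i* y)%C by [].
have K := K_transform_boolean_power H yImz.
have Gmu : cauchy_transform mu (0 +i* y)%C = (0 +i* (- (y * resolvent mu t)))%C.
  apply/eqP; rewrite eq_complex Re_cauchy_transform// eqxx/=.
  by have := Im_cauchy_transform mu y0; rewrite yt => /= ->.
have ImGnu := Im_cauchy_transform nu y0; rewrite yt in ImGnu.
(* Since 1 / G_mu(iy) = i / (y S_mu(t)), additivity of K gives 1 / G_nu(iy) = ih. Comparing Im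
   G_nu(iy) = -1/h with -y S_nu(t) then yields 1 / S_nu(t) = yh. *)
pose h := y - n%:R * (y - (y * resolvent mu t)^-1).
have : (cauchy_transform nu (0 +i* y)%C)^-1 = (0 +i* h)%C.
  have -> : (cauchy_transform nu (0 +i* y)%C)^-1 =
      (0 +i* y)%C - K_transform nu (0 +i* y)%C by rewrite /K_transform subKr.
  rewrite K /K_transform Gmu complex_imag_inv.
  have -> : ((0 +i* y) - (0 +i* (- (- (y * resolvent mu t))^-1)))%C =
      (0 +i* (y - (y * resolvent mu t)^-1))%C.
    by apply/eqP; rewrite eq_complex /= subr0 invrN opprK !eqxx.
  by rewrite complexMn mul0rn; apply/eqP; rewrite eq_complex /= subr0 /h mulr_natl !eqxx.
move/(congr1 GRing.inv); rewrite invrK complex_imag_inv => Gnu.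
rewrite Gnu/= in ImGnu.
have -> : (resolvent nu t)^-1 = y * h.
  move/oppr_inj: ImGnu => /(congr1 GRing.inv); rewrite invrK invfM => ->.
  by rewrite mulrA mulfV ?mul1r// gt_eqF.
by rewrite /h -yt; field; rewrite yt !gt_eqF.
Qed.

(** * Moments as limits of the resolvent *)

Lemma cvgn_EFin (R : realType) (u : nat -> R) (a : R) :
  u @ \oo --> a -> (u k)%:E @[k --> \oo] --> a%:E.
Proof. by move=> ua; apply: cvg_EFin ua; exact: nearW. Qed.

(** The factor a / (x^2 + a) increases to 1 with a, so monotone convergence applies and the limit
    may be infinite. *)
Lemma cvg_integral_truncation (R : realType) (P : probR R) (g : R -> R) :
  measurable_fun [set: measurableTypeR R] g -> (forall x, 0 <= g x) ->
  (\int[P]_x (g x * (k.+1%:R / (x ^+ 2 + k.+1%:R)))%:E)%E @[k --> \oo] -->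
  (\int[P]_x (g x)%:E)%E.
Proof.
move=> mg g0.
pose h k (x : R) : R := g x * (k.+1%:R / (x ^+ 2 + k.+1%:R)).
(* Written with [harmonic k], which is 1/(k + 1), the factor shows both its limit and its
   monotonicity. *)
have hE (k : nat) (x : R) : h k x = g x * (1 + x ^+ 2 * harmonic k)^-1.
  rewrite /h /harmonic /=; congr (_ * _).
  have k0 : 0 < k.+1%:R :> R by rewrite ltr0n.
  have xk := sqrD_gt0 x k0.
  move: (k.+1%:R) k0 xk => a a0 xa.
  have -> : 1 + x ^+ 2 * a^-1 = (x ^+ 2 + a) / a.
    by rewrite mulrDl mulfV ?gt_eqF// addrC.
  by rewrite invf_div.
have h0 (x : R) k : 0 < 1 + x ^+ 2 * harmonic k.
  by rewrite ltr_pwDl// mulr_ge0 ?sqr_ge0 ?harmonic_ge0.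
have -> : (\int[P]_x (g x)%:E = \int[P]_x limn (fun k => (h k x)%:E))%E.
  apply: eq_integral => x _; apply/esym/cvg_lim => //.
  apply: cvgn_EFin.
  rewrite [X in X @ _](_ : _ = fun k => g x * (1 + x ^+ 2 * harmonic k)^-1); last first.
    by apply/funext => k; exact: hE.
  suff : g x * (1 + x ^+ 2 * harmonic k)^-1 @[k --> \oo] --> g x * (1 + x ^+ 2 * 0)^-1.
    by rewrite mulr0 addr0 invr1 mulr1.
  apply: cvgM; first exact: cvg_cst.
  apply: cvgV; first by rewrite mulr0 addr0 oner_neq0.
  by apply: cvgD; [exact: cvg_cst|apply: cvgM; [exact: cvg_cst|exact: cvg_harmonic]].
apply: cvg_monotone_convergence => //.
- move=> k; apply/measurable_EFinP; apply: measurable_funM => //.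
  by apply: measurable_funM => //; exact: measurable_resolvent.
- move=> k x _; rewrite lee_fin -/(h k x) hE mulr_ge0// invr_ge0.
  exact: ltW.
- move=> x _ k l kl; rewrite lee_fin -/(h k x) -/(h l x) !hE.
  rewrite ler_wpM2l// lef_pV2 ?posrE// lerD2l ler_wpM2l ?sqr_ge0//.
  by rewrite /harmonic/= lef_pV2 ?posrE ?ltr0n// ler_nat.
Qed.

(** Monotone convergence as t = 1/(k + 1) decreases to 0; at x = 0 the integrand is k + 1, in
    accordance with 1/0 = [+oo]. *)
Lemma cvg_resolvent0 (R : realType) (P : probR R) :
  ((resolvent P (harmonic k))%:E @[k --> \oo] --> Psi_star P)%E.
Proof.
have hS k : (\int[P]_x ((x ^+ 2 + harmonic k)^-1)%:E = (resolvent P (harmonic k))%:E)%E.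
  by rewrite (has_mean_resolvent P (harmonic_gt0 k)).2.
under eq_cvg do rewrite -hS.
have -> : (Psi_star P = \int[P]_x limn (fun k => ((x ^+ 2 + harmonic k)^-1)%:E))%E.
  apply: eq_integral => x _; apply/esym/cvg_lim => //.
  rewrite inver sqrf_eq0; have [->|x0] := eqVneq x 0.
    rewrite expr0n/=; under eq_cvg do rewrite add0r invrK.
    apply/cvgenyP.
    by apply/cvgnyPge => A; near=> n; apply: leqW; near: n; exact: nbhs_infty_ge.
  apply: cvgn_EFin.
  apply: cvgV; first by rewrite sqrf_eq0.
  suff : x ^+ 2 + harmonic k @[k --> \oo] --> x ^+ 2 + 0 by rewrite addr0.
  by apply: cvgD; [exact: cvg_cst|exact: cvg_harmonic].
apply: cvg_monotone_convergence => //.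
- by move=> k; apply/measurable_EFinP; exact: measurable_resolvent.
- by move=> k x _; rewrite lee_fin invr_ge0 ltW// sqrD_gt0// harmonic_gt0.
- move=> x _ k l kl; rewrite lee_fin lef_pV2 ?posrE ?sqrD_gt0 ?harmonic_gt0//.
  by rewrite lerD2l /harmonic/= lef_pV2 ?posrE ?ltr0n// ler_nat.
Unshelve. all: by end_near. Qed.

Section resolvent_infinity.
Context (R : realType) (P : probR R).
Let t (k : nat) : R := k.+1%:R.
(** A truncated second moment: t - t^2 / (x^2 + t) = x^2 t / (x^2 + t). *)
Let A k := t k - t k ^+ 2 * resolvent P (t k).

Let t0 k : 0 < t k. Proof. by rewrite /t ltr0n. Qed.

Let hA k : has_mean P (fun x => x ^+ 2 * (t k / (x ^+ 2 + t k))) (A k).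
Proof.
have := has_meanD (has_mean_cst P (t k))
  (has_meanZ (- t k ^+ 2) (has_mean_resolvent P (t0 k))).
rewrite /A mulNr; congr (has_mean P _ _); apply/funext => x /=.
have := sqrD_gt0 x (t0 k); move: (t k) => a xa.
by field; rewrite gt_eqF.
Qed.

Lemma cvg_resolvent_moment2 : ((A k)%:E @[k --> \oo] --> moment P 2)%E.
Proof.
have := @cvg_integral_truncation R P _ (@exprn_measurable R setT 2) (@sqr_ge0 R).
by under eq_cvg do rewrite -/(t _) (hA _).2.
Qed.

(** The remainder t(m - A) is a truncated fourth moment, since t(x^2 - x^2 t / (x^2 + t)) = x^4 t /
    (x^2 + t). *)
Lemma cvg_resolvent_moment4 (m : R) : moment P 2 = m%:E ->
  ((t k * (m - A k))%:E @[k --> \oo] --> moment P 4)%E.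
Proof.
move=> hm.
have hm2 : has_mean P (fun x => x ^+ 2) m.
  by apply: has_mean_ge0 => // x; exact: sqr_ge0.
have hB k : has_mean P (fun x => x ^+ 4 * (t k / (x ^+ 2 + t k))) (t k * (m - A k)).
  have := has_meanZ (t k) (has_meanD hm2 (has_meanZ (- 1) (hA k))).
  rewrite mulN1r; congr (has_mean P _ _); apply/funext => x /=.
  have := sqrD_gt0 x (t0 k); rewrite /A; move: (t k) => a xa.
  by field; rewrite gt_eqF.
have x4 (x : R) : 0 <= x ^+ 4 by exact: exprn_even_ge0.
have := @cvg_integral_truncation R P _ (@exprn_measurable R setT 4) x4.
by under eq_cvg do rewrite -/(t _) (hB _).2.
Qed.

End resolvent_infinity.

(** * Moments of Boolean powers *)

Lemma boolean_power_gt0 (R : realType) (mu nu : probR R) (n : nat) :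
  is_boolean_power mu n nu -> (0 < n)%N.
Proof. by case. Qed.

Section boolean_power.
Context (R : realType) (mu nu : probR R) (n : nat).
Hypotheses (smu : symmetric_law mu) (nu_pow : is_boolean_power mu n nu).
Let t (k : nat) : R := k.+1%:R.
Let A (P : probR R) k := t k - t k ^+ 2 * resolvent P (t k).

Let t0 k : 0 < t k. Proof. by rewrite /t ltr0n. Qed.

Let n1 : 1 <= n%:R :> R.
Proof. by rewrite ler1n (boolean_power_gt0 nu_pow). Qed.

Let denom_gt0 (s : R) : 0 < s -> 0 < 1 + (n%:R - 1) * (1 - s * resolvent mu s).
Proof.
move=> s0; rewrite ltr_pwDl// mulr_ge0// subr_ge0//.
exact: resolvent_le.
Qed.

(** The relation of [resolvent_boolean_power] solved for S_nu. As 0 < s S_mu(s) <= 1, the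
    denominator lies between 1 and n. *)
Let resolvent_nuE (s : R) : 0 < s -> resolvent nu s =
  resolvent mu s / (1 + (n%:R - 1) * (1 - s * resolvent mu s)).
Proof.
move=> s0; have D0 := denom_gt0 s0; have S0 := resolvent_gt0 mu s0.
apply: invr_inj; rewrite (resolvent_boolean_power smu nu_pow s0) invf_div.
by field; rewrite gt_eqF.
Qed.

(** Since A/t = 1 - t S_mu(t), the denominator tends to 1 at infinity as soon as A converges. *)
Let denomE k : 1 + (n%:R - 1) * A mu k * harmonic k =
  1 + (n%:R - 1) * (1 - t k * resolvent mu (t k)).
Proof.
rewrite /A /harmonic/= -/(t k); have := t0 k; move: (t k) => a a0.
by field; rewrite gt_eqF.
Qed.

Let AE k : A nu k = n%:R * A mu k / (1 + (n%:R - 1) * A mu k * harmonic k).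
Proof.
rewrite denomE /A (resolvent_nuE (t0 k)).
have := denom_gt0 (t0 k); move: (t k) => a D0.
by field; rewrite gt_eqF.
Qed.

Let cvgA : moment mu 2 = 1%E -> A mu @ \oo --> (1 : R).
Proof.
by move=> m2; have := @cvg_resolvent_moment2 R mu; rewrite m2 => /fine_cvg.
Qed.

Let cvg_denom : moment mu 2 = 1%E ->
  1 + (n%:R - 1) * A mu k * harmonic k @[k --> \oo] --> (1 : R).
Proof.
move=> m2.
suff : 1 + (n%:R - 1) * A mu k * harmonic k @[k --> \oo] -->
  (1 + (n%:R - 1) * 1 * 0 : R) by rewrite mulr0 addr0.
apply: cvgD; first exact: cvg_cst.
apply: cvgM; last exact: cvg_harmonic.
by apply: cvgM; [exact: cvg_cst|exact: cvgA].
Qed.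

Lemma moment2_boolean_power : moment mu 2 = 1%E -> moment nu 2 = (n%:R)%:E.
Proof.
move=> m2; apply: (cvg_unique _ (@cvg_resolvent_moment2 R nu)) => //.
apply: cvgn_EFin; rewrite [X in X @ _](_ : _ = fun k =>
  n%:R * A mu k / (1 + (n%:R - 1) * A mu k * harmonic k)); last first.
  by apply/funext => k; exact: AE.
suff : n%:R * A mu k / (1 + (n%:R - 1) * A mu k * harmonic k) @[k --> \oo] -->
  n%:R * 1 / (1 : R) by rewrite mulr1 divr1.
apply: cvgM; last by apply: cvgV; [exact: oner_neq0|exact: cvg_denom].
by apply: cvgM; [exact: cvg_cst|exact: cvgA].
Qed.

Lemma moment4_boolean_power (m4 : R) : moment mu 2 = 1%E ->
  moment mu 4 = m4%:E -> moment nu 4 = (n%:R * (m4 + (n%:R - 1)))%:E.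
Proof.
move=> m2 hm4.
apply: (cvg_unique _ (cvg_resolvent_moment4 (moment2_boolean_power m2))) => //.
(* With D the denominator, t(n - n A/D) = n t(D - A)/D and t(D - A) = t(1 - A) + (n - 1)A; here t(1
   - A) tends to m_4(mu). *)
apply: cvgn_EFin; rewrite [X in X @ _](_ : _ = fun k =>
  n%:R * (t k * (1 - A mu k) + (n%:R - 1) * A mu k) / 
  (1 + (n%:R - 1) * A mu k * harmonic k)); last first.
  apply/funext => k; rewrite -/(t k) -/(A nu k) AE.
  have : 0 < 1 + (n%:R - 1) * A mu k * harmonic k by rewrite denomE denom_gt0.
  rewrite /harmonic/= -/(t k); move: (A mu k) (t0 k) => B; move: (t k) => a a0 D0.
  (* [field] clears 1/a inside the denominator and asks for this form to be nonzero. *)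
  have D0' : a + (n%:R - 1) * B != 0.
    have -> : a + (n%:R - 1) * B = a * (1 + (n%:R - 1) * B / a).
      by field; rewrite gt_eqF.
    by rewrite mulf_neq0// gt_eqF.
  by field; rewrite D0' gt_eqF.
suff : n%:R * (t k * (1 - A mu k) + (n%:R - 1) * A mu k) /
    (1 + (n%:R - 1) * A mu k * harmonic k) @[k --> \oo] -->
    n%:R * (m4 + (n%:R - 1) * 1) / (1 : R) by rewrite mulr1 divr1.
apply: cvgM; last by apply: cvgV; [exact: oner_neq0|exact: cvg_denom].
apply: cvgM; first exact: cvg_cst.
apply: cvgD; last by apply: cvgM; [exact: cvg_cst|exact: cvgA].
by have := cvg_resolvent_moment4 m2; rewrite hm4 => /fine_cvg.
Qed.

Lemma Psi_star_boolean_power : (n%:R%:E * Psi_star nu = Psi_star mu)%E.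
Proof.
have n0 : 0 < n%:R :> R by exact: lt_le_trans n1.
have Smu := cvg_resolvent0 (P := mu); have Snu := cvg_resolvent0 (P := nu).
have h0 k := @harmonic_gt0 R k.
have Smu0 : (0 <= Psi_star mu)%E.
  by apply: integral_ge0 => x _; rewrite inve_ge0 lee_fin sqr_ge0.
have nSnu : ((n%:R * resolvent nu (harmonic k))%:E @[k --> \oo] -->
    n%:R%:E * Psi_star nu)%E.
  by under eq_cvg do rewrite EFinM; apply: cvgeZl.
have nSnuE k : n%:R * resolvent nu (harmonic k) = n%:R * resolvent mu (harmonic k) /
    (1 + (n%:R - 1) * (1 - harmonic k * resolvent mu (harmonic k))).
  by rewrite resolvent_nuE// mulrA.
(* The denominator is at most n, so n S_nu >= S_mu and an infinite limit passes to nu. *)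
have [Soo|Sfin] := eqVneq (Psi_star mu) +oo%E.
  rewrite Soo; apply/eqP; rewrite -leye_eq -Soo.
  apply: lee_cvg_to Smu nSnu _; apply: nearW => k; rewrite lee_fin nSnuE.
  have D0 := denom_gt0 (h0 k); have S0 := resolvent_gt0 mu (h0 k).
  rewrite ler_pdivlMr// mulrC ler_pM2r//.
  have : 0 <= (n%:R - 1) * (harmonic k * resolvent mu (harmonic k)).
    by rewrite !mulr_ge0 ?subr_ge0 ?(ltW S0) ?(ltW (h0 k)).
  lra.
have [M EM] : exists M, Psi_star mu = M%:E.
  by exists (fine (Psi_star mu)); rewrite fineK// ge0_fin_numE// ltey.
rewrite EM; apply: (cvg_unique _ nSnu) => //; apply: cvgn_EFin.
rewrite EM in Smu; move/fine_cvg: Smu => Smu.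
rewrite (_ : (fun k => _) = fun k => n%:R * resolvent mu (harmonic k) /
    (1 + (n%:R - 1) * (1 - harmonic k * resolvent mu (harmonic k)))); last first.
  by apply/funext.
(* When S_mu has a finite limit M, s S_mu(s) tends to 0 and the denominator to n. *)
suff : n%:R * resolvent mu (harmonic k) /
    (1 + (n%:R - 1) * (1 - harmonic k * resolvent mu (harmonic k))) @[k --> \oo]
    --> n%:R * M / (1 + (n%:R - 1) * (1 - 0 * M)).
  have -> : n%:R * M / (1 + (n%:R - 1) * (1 - 0 * M)) = M.
    by rewrite mul0r subr0 mulr1 [1 + _]addrC subrK mulrAC mulfV ?mul1r// gt_eqF.
  by [].
apply: cvgM; first by apply: cvgM => //; exact: cvg_cst.
apply: cvgV; first by rewrite mul0r subr0 mulr1 addrC subrK gt_eqF.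
apply: cvgD; first exact: cvg_cst.
apply: cvgM; first exact: cvg_cst.
apply: cvgB; first exact: cvg_cst.
by apply: cvgM => //; exact: cvg_harmonic.
Qed.

End boolean_power.


(** * Dilation and conclusion *)

Lemma integral_dilation (R : realType) (c : R) (P : probR R) (f : R -> \bar R) :
  measurable_fun [set: measurableTypeR R] f -> (forall x, 0 <= f x)%E ->
  (\int[dilation c P]_x f x = \int[P]_x f (c * x)%R)%E.
Proof. by move=> mf f0; rewrite ge0_integral_distribution. Qed.

Theorem proposition3p11 (R : realType) (mu : probR R)
  (mu_sym : symmetric_law mu)
  (mu_m1 : moment mu 1 = 0%E)
  (mu_m2 : moment mu 2 = 1%E)
  (mu_m4 : (moment mu 4 < +oo)%E)
  (n : nat) (n_ge1 : (1 <= n)%N)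
  (nu : probR R) (nu_pow : is_boolean_power mu n nu) :
  let mu_n : probR R := dilation ((Num.sqrt n%:R)^-1) nu in
  (Psi mu_n <= Psi_star mu_n * D_star mu_n)%E /\
  (Psi_star mu_n * D_star mu_n =
   ((Num.sqrt n%:R)^-1)%:E * moment mu (-2) * sqrte (moment mu 4 - 1))%E.
Proof.
move=> mu_n.
have n0 : 0 < n%:R :> R by rewrite ltr0n.
have [m4 Em4] : exists m4, moment mu 4 = m4%:E.
  exists (fine (moment mu 4)); rewrite fineK// ge0_fin_numE//.
  by apply: integral_ge0 => x _; rewrite lee_fin exprn_even_ge0.
have scaled (x : R) : ((Num.sqrt n%:R)^-1 * x) ^+ 2 = n%:R^-1 * x ^+ 2.
  by rewrite exprMn exprVn sqr_sqrtr// ltW.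
have hX2 : has_mean nu (fun x => x ^+ 2) n%:R.
  apply: has_mean_ge0 => //; first by move=> x; exact: sqr_ge0.
  exact: (moment2_boolean_power mu_sym nu_pow mu_m2).
have hX4 : has_mean nu (fun x => x ^+ 4) (n%:R * (m4 + (n%:R - 1))).
  apply: has_mean_ge0; first exact: exprn_measurable.
    by move=> x; exact: exprn_even_ge0.
  exact: (moment4_boolean_power mu_sym nu_pow mu_m2 Em4).
have X1 : (\int[mu_n]_x (x ^+ 2)%:E = 1)%E.
  rewrite integral_dilation; last 2 first.
  - by apply/measurable_EFinP; exact: exprn_measurable.
  - by move=> x; rewrite lee_fin sqr_ge0.
  under eq_integral do rewrite scaled.
  by rewrite (has_meanZ n%:R^-1 hX2).2 mulVf ?gt_eqF.
have V1 : (\int[mu_n]_x ((x ^+ 2 - 1) ^+ 2)%:E = (n%:R^-1 * (m4 - 1))%:E)%E.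
  rewrite integral_dilation; last 2 first.
  - apply/measurable_EFinP; apply: measurable_funX; apply: measurable_funB => //.
  - by move=> x; rewrite lee_fin sqr_ge0.
  under eq_integral do rewrite scaled.
  (* Expanding (x^2/n - 1)^2 gives the mean (m_4 + n - 1)/n - 2 + 1 = (m_4 - 1)/n. *)
  have := has_meanD (has_meanZ (n%:R^-1 ^+ 2) hX4)
    (has_meanD (has_meanZ (- (2 * n%:R^-1)) hX2) (has_mean_cst nu 1)).
  move=> [_ h].
  transitivity (\int[nu]_x (n%:R^-1 ^+ 2 * x ^+ 4 +
      (- (2 * n%:R^-1) * x ^+ 2 + cst 1 x))%:E)%E.
    by apply: eq_integral => x _ /=; congr (_%:E); ring.
  by rewrite h; congr (_%:E); field; rewrite gt_eqF.
have S1 : (Psi_star mu_n = moment mu (-2))%E.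
  (* [moment mu (-2)] unfolds to [Psi_star mu]. Dilation multiplies 1/x^2 by n, which cancels the
     factor 1/n due to the Boolean power. *)
  rewrite -[RHS](Psi_star_boolean_power mu_sym nu_pow).
  have mS : measurable_fun [set: measurableTypeR R] (fun x : R => ((x ^+ 2)%:E)^-1%E).
    by apply: measurable_inve_EFin; exact: exprn_measurable.
  have S0 (x : R) : (0 <= ((x ^+ 2)%:E)^-1)%E by rewrite inve_ge0 lee_fin sqr_ge0.
  rewrite /Psi_star integral_dilation// -ge0_integralZl ?lee_fin ?(ltW n0)//.
  apply: eq_integral => x _; rewrite scaled !inver mulf_eq0 invr_eq0 (gt_eqF n0)/=.
  case: ifPn => _; first by rewrite gt0_muley.
  by rewrite invfM invrK.
split; first by apply: Psi_le => //; rewrite V1 ltry.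
rewrite S1 /D_star V1 Em4 /= sqrtrM ?invr_ge0 ?ltW// sqrtrV ?ltW//.
by rewrite EFinM muleA (muleC (moment mu (-2))).
Qed.
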